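(* Let $k\ge 2$, and let $\mathcal{A}\in\mathbb{R}^{N\times N}$, $N=(k-1)n+k+1$, be the matrix $\mathcal{A}=\begin{pmatrix} D\mathbf{F}(\mathbf{z})\\ \mathbf{T}^t\end{pmatrix}$ of the multiple shooting problem on $k$ intervals defined in the context, assumed nonsingular. Assume that all eigenvalues of $\mathcal{A}$ other than $\lambda_0=1$ are simple. Then, in exact arithmetic, the number of GMRES iterations necessary to solve the linear system $$\mathcal{A}\,\delta\mathbf{z}=-\begin{pmatrix}\mathbf{F}(\mathbf{z})\\ 0\end{pmatrix}$$ is at most $3k-1$; that is, the GMRES residual is zero after at most $3k-1$ iterations.
   Context: **Dynamical system.** Let $\dot{\mathbf{x}}=\mathbf{f}(\mathbf{x})$, $\mathbf{x}\in\mathbb{R}^n$, be a smooth system of ODEs with flow $\phi(\mathbf{x},t)$. Let $\bar{\mathbf{x}}$ lie on a hyperbolic periodic solution of period $P$, $\phi(\bar{\mathbf{x}},P)=\bar{\mathbf{x}}$. Its monodromy matrix $\mathbf{M}=D_{\mathbf{x}}\phi(\bar{\mathbf{x}},P)$ has exactly one eigenvalue $\mu_1$ outside the unit circle, with eigenvector $\mathbf{u}_1$, $\mathbf{M}\mathbf{u}_1=\mu_1\mathbf{u}_1$. The vector $\mathbf{f}(\bar{\mathbf{x}})$ is an eigenvector of $\mathbf{M}$ for the eigenvalue $1$. **Multiple shooting.** An orbit is represented by $k\ge2$ segments $\gamma^{(i)}(t)=\phi(\gamma^{(i)}(0),t)$, $0\le t\le T^{(i)}$, $i=1,\dots,k$.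 The first segment starts at $\gamma^{(1)}(0)=\bar{\mathbf{x}}+\epsilon\mathbf{u}_1$, with $\epsilon$ a small real parameter. The vector of $N=(k-1)n+k+1$ unknowns is $$\mathbf{z}=(\gamma^{(2)}(0),\dots,\gamma^{(k)}(0),T^{(1)},\dots,T^{(k)},\epsilon).$$ The $N-1$ equations $\mathbf{F}(\mathbf{z})=0$ are given by $$\mathbf{F}=\big(\gamma^{(2)}(0)-\gamma^{(1)}(T^{(1)}),\dots,\gamma^{(k)}(0)-\gamma^{(k-1)}(T^{(k-1)}),\ g^{(1)}(\gamma^{(1)},T^{(1)})-c_1,\dots,g^{(k)}(\gamma^{(k)},T^{(k)})-c_k\big),$$ where the $c_i$ are constants and each $g^{(i)}$ is a scalar function(al) giving the right boundary condition on segment $i$, differentiable as a function of $(\gamma^{(i)}(0),T^{(i)})$. The choices used are: $g(\gamma,T)=T$ (fixed integration time); $g(\gamma,T)=\int_0^T|\mathbf{f}(\gamma(t))|\,dt$ (constant arc length); $g(\gamma,T)=g(\gamma(T))$ (end point on a Poincaré surface). The type may differ from segment to segment. **The matrix $\mathcal{A}$.** Let $\mathbf{T}\in\mathbb{R}^N$ be the given (tangent) vector used in the arclength continuation step, with components $\mathbf{T}^t=(\mathbf{t}_1,\dots,\mathbf{t}_{k-1},t_1,\dots,t_{k+1})$, where each $\mathbf{t}_i$ is a row vector of length $n$ and each $t_i$ is a scalar. The matrix $\mathcal{A}$ is $D\mathbf{F}$, evaluated at the current point $\mathbf{z}$, with $\mathbf{T}^t$ appended as last row. Explicitly $$\mathcal{A}=\begin{pmatrix}\mathcal{A}'&\mathbf{A}\\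 \mathbf{B}&\mathbf{C}\end{pmatrix},$$ where: - $\mathcal{A}'$ is the $(k-1)n\times(k-1)n$ block lower bidiagonal matrix with identity blocks $\mathbb{I}_n$ on the diagonal and blocks $-\mathbf{J}_2,\dots,-\mathbf{J}_{k-1}$ on the subdiagonal ($-\mathbf{J}_i$ in block row $i$, block column $i-1$), with $\mathbf{J}_i=D_{\mathbf{x}}\phi(\gamma^{(i)}(0),T^{(i)})$. - $\mathbf{A}$ is $(k-1)n\times(k+1)$; its block row $i$ has $\mathbf{a}_i=-\mathbf{f}(\gamma^{(i)}(T^{(i)}))$ in column $i$ ($i=1,\dots,k-1$), block row $1$ has in addition $\bar{\mathbf{a}}=-\mathbf{J}_1\mathbf{u}_1$ in column $k+1$, and all other entries are zero. - $\mathbf{B}$ is $(k+1)\times(k-1)n$; its row $1$ is zero, row $i$ ($2\le i\le k$) has the row vector $\mathbf{b}_i=\partial g^{(i)}/\partial\gamma^{(i)}(0)$ in block column $i-1$ and zeros elsewhere, and row $k+1$ is $(\mathbf{t}_1,\dots,\mathbf{t}_{k-1})$. - $\mathbf{C}$ is $(k+1)\times(k+1)$; its row $i$ ($1\le i\le k$) has $c_{ii}=\partial g^{(i)}/\partial T^{(i)}$ in column $i$, row $1$ has in addition $\bar c=\partial g^{(1)}/\partial\epsilon$ in column $k+1$, row $k+1$ is $(t_1,\dots,t_{k+1})$, and all other entries are zero. **Conventions.** Eigenvalues are taken in $\mathbb{C}$; ''simple'' means of algebraic multiplicity one. GMRES for a linear system $\mathcal{A}\mathbf{x}=\mathbf{b}$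 with initial guess $\mathbf{x}_0$ and initial residual $\mathbf{r}_0=\mathbf{b}-\mathcal{A}\mathbf{x}_0$ produces as its $p$-th iterate the vector $\mathbf{x}_p$ minimising $\|\mathbf{b}-\mathcal{A}\mathbf{x}\|_2$ over $\mathbf{x}\in\mathbf{x}_0+\mathrm{span}\{\mathbf{r}_0,\mathcal{A}\mathbf{r}_0,\dots,\mathcal{A}^{p-1}\mathbf{r}_0\}$. *)

(* Defs.v *)
From HB Require Import structures.
From mathcomp Require Import all_boot all_order all_algebra.
From mathcomp Require Import complex.
From mathcomp Require Import all_classical all_reals all_analysis.

Set Implicit Arguments.
Unset Strict Implicit.
Unset Printing Implicit Defensive.

Import Order.TTheory GRing.Theory Num.Theory.
Import numFieldNormedType.Exports.

Local Open Scope classical_set_scope.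
Local Open Scope ring_scope.

(* Points and vector fields of R^n are row vectors, as required by the         *)
(* library's [jacobian], which is the transpose of the usual Jacobian matrix:  *)
(* ['d f p v = v *m jacobian f p].  Linear systems use column vectors.         *)

Section Dynamics.
Variables (R : realType) (n : nat).
Implicit Types (f : 'rV[R]_n -> 'rV[R]_n) (phi : 'rV[R]_n -> R -> 'rV[R]_n)
  (D : set ('rV[R]_n * R)).

(* Every iterated directional derivative, of any order, is differentiable. *)
Definition smooth f : Prop :=
  forall (vs : seq 'rV[R]_n) (x : 'rV[R]_n),
    differentiable (foldr (fun v h => 'D_v h) f vs) x.

(* [phi] is the flow of x' = f(x) on the open domain [D]; solutions need not   *)
(* exist for all times, and values of [phi] outside [D] are irrelevant.  A     *)
(* complete flow is the case [D = setT].  Smoothness of [phi] on [D] is not    *)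
(* required, since it follows from that of [f].                                *)
Definition is_flow f D phi : Prop :=
  [/\ open D,
      forall x, D (x, 0) /\ phi x 0 = x,
      forall x t s, D (x, t) -> 0 <= s <= t \/ t <= s <= 0 -> D (x, s) &
      forall x t, D (x, t) -> is_derive t 1 (phi x) (f (phi x t))].

Definition monodromy phi (x : 'rV[R]_n) (P : R) : 'M[R]_n :=
  (jacobian (phi^~ P) x)^T.

End Dynamics.

Section ComplexEigenvalues.
Variables (R : realType) (n : nat).
Implicit Types (M : 'M[R]_n) (l : R[i]).

Definition ceigenvalue M l : Prop := eigenvalue (map_mx (real_complex R) M) l.

Definition simple_ceigenvalue M l : Prop :=
  mup l (char_poly (map_mx (real_complex R) M)) = 1%N.

End ComplexEigenvalues.

(* [f x != 0] excludes equilibria; [f x] is then an eigenvector of the         *)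
(* monodromy matrix for the trivial multiplier 1.                              *)
Definition hyperbolic_periodic_point (R : realType) (n : nat)
    (f : 'rV[R]_n -> 'rV[R]_n) (D : set ('rV[R]_n * R))
    (phi : 'rV[R]_n -> R -> 'rV[R]_n) (x : 'rV[R]_n) (P : R) : Prop :=
  [/\ 0 < P, D (x, P), phi x P = x & f x != 0] /\
  simple_ceigenvalue (monodromy phi x P) 1 /\
  (forall l : R[i],
     ceigenvalue (monodromy phi x P) l -> `|l| = 1 -> l = 1).

(* The only multiplier outside the unit circle is [mu1], with eigenvector      *)
(* [u1].  They are real because non-real multipliers come in conjugate pairs.  *)
Definition one_unstable_multiplier (R : realType) (n : nat)
    (M : 'M[R]_n) (mu1 : R) (u1 : 'rV[R]_n) : Prop :=
  [/\ 1 < `|mu1|, u1 != 0, M *m u1^T = mu1 *: u1^T &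
      forall l : R[i], ceigenvalue M l -> 1 < `|l| -> l = real_complex R mu1].

(* Segments are numbered 0, .., k-1 instead of 1, .., k.  The vector of        *)
(* unknowns is z = (nodes, times, eps), where row j of [nodes z] is the        *)
(* initial point of segment j + 1.                                             *)
Section MultipleShooting.
Variables (R : realType) (n k : nat).
Variables (phi : 'rV[R]_n -> R -> 'rV[R]_n) (xbar u1 : 'rV[R]_n).
(* Boundary conditions are functionals g i (gamma, T) of an orbit segment,     *)
(* e.g. T, the integral over [0, T] of |f (gamma t)|, or a function of the     *)
(* end point gamma T.                                                          *)
Variables (g : 'I_k -> (R -> 'rV[R]_n) -> R -> R) (c : 'I_k -> R).
Implicit Type z : 'rV[R]_(k.-1 * n + k + 1).

Definition nodes z : 'M[R]_(k.-1, n) := vec_mx (lsubmx (lsubmx z)).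
Definition seg_time z (i : 'I_k) : R := rsubmx (lsubmx z) 0 i.
Definition eps z : R := rsubmx z 0 0.

Definition seg_start z (i : 'I_k) : 'rV[R]_n :=
  if [pick j : 'I_k.-1 | j.+1 == i] is Some j then row j (nodes z)
  else xbar + eps z *: u1.

Definition segment z (i : 'I_k) : R -> 'rV[R]_n := phi (seg_start z i).

Definition matching z : 'M[R]_(k.-1, n) :=
  \matrix_(j < k.-1)
    let i := widen_ord (leq_pred k) j in
    row j (nodes z) - segment z i (seg_time z i).

Definition boundary z : 'rV[R]_k :=
  \row_(i < k) (g i (segment z i) (seg_time z i) - c i).

Definition shooting_map z : 'rV[R]_(k.-1 * n + k) :=
  row_mx (mxvec (matching z)) (boundary z).

Definition shooting_matrix z (tau : 'rV[R]_(k.-1 * n + k + 1)) :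
    'M[R]_(k.-1 * n + k + 1) :=
  col_mx (jacobian shooting_map z)^T tau.

Definition shooting_rhs z : 'cV[R]_(k.-1 * n + k + 1) :=
  - col_mx (shooting_map z)^T 0.

End MultipleShooting.

Section GMRES.
Variables (R : realType) (N : nat) (A : 'M[R]_N) (b x0 : 'cV[R]_N).

(* The norm of the library's normed module 'cV[R]_N is the sup norm. *)
Definition norm2 (v : 'cV[R]_N) : R := Num.sqrt (\sum_(i < N) v i 0 ^+ 2).

Definition residual (x : 'cV[R]_N) : 'cV[R]_N := b - A *m x.

Definition krylov_affine (p : nat) : set 'cV[R]_N :=
  [set x | exists a : 'I_p -> R,
     x = x0 + \sum_(j < p) a j *: (A ^+ j *m residual x0)].

Definition gmres_iterate (p : nat) (xp : 'cV[R]_N) : Prop :=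
  krylov_affine p xp /\
  forall x, krylov_affine p x -> norm2 (residual xp) <= norm2 (residual x).

End GMRES.

(* Main.v *)
(* Put X = A - 1 and follow the iterates X^q y.  If the part of X^q y that      *)
(* belongs to segment i (initial point and time) vanishes, then X^(q+1) y has  *)
(* no i-th time component and no variation of the initial point of segment     *)
(* i+1, because the corresponding equations read A off the identity block and  *)
(* segment i only.  By induction on the segments, X^(k-1) y = 0 as soon as the *)
(* 2k scalars time_i(X^i y) and eps(X^i y), i < k, vanish.  Hence, for each r, *)
(* a nonzero q(X) with deg q <= 2k satisfies X^(k-1) q(X) r = 0, and dividing  *)
(* by powers of the invertible A yields r = A s(A) r with deg s <= 3k-2.       *)

Require Import Defs.
From mathcomp Require Import all_boot all_order all_algebra.
From mathcomp Require Import complex.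
From mathcomp Require Import all_classical all_reals all_analysis.
Set Implicit Arguments.
Unset Strict Implicit.
Unset Printing Implicit Defensive.

Import Order.TTheory GRing.Theory Num.Theory.
Import numFieldNormedType.Exports.
Local Open Scope classical_set_scope.
Local Open Scope ring_scope.

(** For invertible A, GMRES is exact at step p once a nonzero polynomial of degree at most p in A
    kills the initial residual ([gmres_annihilated]). Vectors satisfying 2k linear conditions are
    killed by the (k-1)-st power of A - 1 ([shooting_nilpotent]), so a dimension count
    ([krylov_annihilator]) gives such a polynomial with p = 2k + (k-1) = 3k-1. The sparsity of A is
    read off directional derivatives of the shooting map. *)

Lemma diff_not_differentiable (R : numFieldType) (V W : normedModType R)
    (f : V -> W) (x : V) :
  ~ differentiable f x -> 'd f x = \0 :> (V -> W).
Proof.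
(* ['d f x] is chosen by [get] from [P]; when nothing satisfies [P], the choice is the default
   point, the null map. *)
move=> ndf; set P := fun df : {linear V -> W} => continuous df /\
  forall y, f y = f (lim (nbhs x)) + df (y - lim (nbhs x))
                  +o_(y \near x) (y - lim (nbhs x)).
have nP df : ~ P df.
  move=> Pdf; apply: ndf; apply/diffP => /=.
  by apply: (@getPex _ P); exists df.
by rewrite (_ : 'd f x = get P)// (getPN nP).
Qed.

(** Serves to differentiate shooting equations along lines on which they are affine, with no chain
    rule through the flow or [g]. *)
Lemma derive_affine_line (R : numFieldType) (V W : normedModType R)
    (f : V -> W) (a v : V) (w : W) :
  (forall h : R, f (h *: v + a) = f a + h *: w) -> 'D_v f a = w.
Proof.
move=> fE; apply: cvg_lim => //.
apply: cvg_near_cst; near=> h.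
have h0 : h != 0 by near: h; exact: nbhs_dnbhs_neq.
by rewrite /= fE [f a + _]addrC addrK scalerA mulVf// scale1r.
Unshelve. all: by end_near. Qed.

(** * Annihilating polynomials and exact termination of GMRES *)

Section ExactTermination.
Variables (R : realType).

Lemma horner_mx_mulE (N m : nat) (A : 'M[R]_N.+1) (r : 'cV[R]_N.+1)
    (q : {poly R}) :
  (size q <= m)%N ->
  horner_mx A q *m r = \sum_(i < m) q`_i *: (A ^+ i *m r).
Proof.
move=> qm; have {1}-> : q = \sum_(i < m) q`_i *: 'X^i.
  rewrite -poly_def; apply/polyP => i; rewrite coef_poly; case: ltnP => // mi.
  by rewrite nth_default// (leq_trans qm).
rewrite raddf_sum/= mulmx_suml; apply: eq_bigr => i _.
by rewrite linearZ/= rmorphXn/= horner_mx_X scalemxAl.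
Qed.

(** With X = A - c, the d+1 vectors S X^j r, j <= d, are dependent in dimension d. The relation is a
    polynomial in X sending r into the kernel of S, and e more factors X kill the result. *)
Lemma krylov_annihilator (N d e : nat) (A : 'M[R]_N.+1) (S : 'M[R]_(d, N.+1))
    (c : R) (r : 'cV[R]_N.+1) :
  (forall y : 'cV[R]_N.+1, S *m y = 0 -> (A - c%:M) ^+ e *m y = 0) ->
  exists q : {poly R},
    [/\ q != 0, (size q <= (d + e).+1)%N & horner_mx A q *m r = 0].
Proof.
move=> SK; set X := A - c%:M.
pose K : 'M[R]_(d.+1, d) := \matrix_(j, i) (S *m (X ^+ j *m r)) i 0.
have : kermx K != 0.
  by rewrite kermx_eq0 -row_leq_rank -ltnNge ltnS rank_leq_col.
case/rowV0Pn => a /sub_kermxP aK a0.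
have XE : horner_mx A ('X - c%:P) = X.
  by rewrite rmorphB/= horner_mx_X horner_mx_C.
pose q0 := rVpoly a \Po ('X - c%:P).
have q00 : q0 != 0.
  rewrite -size_poly_eq0 size_comp_poly2 ?size_XsubC// size_poly_eq0.
  by apply: contra_neq a0 => a0; rewrite -[a]rVpolyK a0 linear0.
exists (q0 * ('X - c%:P) ^+ e); split.
- by rewrite mulf_neq0// expf_neq0// polyXsubC_eq0.
- rewrite (leq_trans (size_polyMleq _ _))// size_exp_XsubC.
  rewrite addnS/= size_comp_poly2 ?size_XsubC// -addSn leq_add2r.
  exact: size_poly.
- rewrite mulrC rmorphM rmorphXn/= XE -mulmxA; apply: SK.
  have -> : horner_mx A q0 *m r = \sum_(j < d.+1) a 0 j *: (X ^+ j *m r).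
    rewrite /q0 /rVpoly poly_def !raddf_sum/= mulmx_suml.
    apply: eq_bigr => j _; rewrite insubT//= => jd.
    rewrite comp_polyZ comp_Xn_poly linearZ/= rmorphXn/= XE scalemxAl.
    by congr (a _ _ *: _ *m _); apply: val_inj.
  apply/colP => i; rewrite mulmx_sumr summxE.
  move/matrixP : aK => /(_ 0 i); rewrite !mxE => {2}<-.
  by apply: eq_bigr => j _; rewrite -scalemxAr !mxE.
Qed.

Lemma gmres_annihilated (N p : nat) (A : 'M[R]_N.+1) (b x0 : 'cV[R]_N.+1)
    (q : {poly R}) :
  A \in unitmx -> q != 0 -> (size q <= p.+1)%N ->
  horner_mx A q *m residual A b x0 = 0 ->
  exists xp, gmres_iterate A b x0 p xp /\ residual A b xp = 0.
Proof.
move=> Au q0 qp qr; set r := residual A b x0 in qr *.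
(* Dividing q by its power of the indeterminate leaves s with nonzero constant term; s(A) still
   kills r because A is invertible. *)
have [m [s s0 qE]] := multiplicity_XsubC q 0.
move: s0; rewrite q0/= => s0.
have {}s0 : s`_0 != 0 by rewrite -horner_coef0.
have sr : horner_mx A s *m r = 0.
  move: qr; rewrite qE subr0 mulrC rmorphM rmorphXn/= horner_mx_X -mulmxA.
  move/(congr1 (mulmx (invmx (A ^+ m)))); rewrite mulKmx ?mulmx0//.
  exact: (unitrX m Au).
have sp : (size s <= p.+1)%N.
  apply: leq_trans qp; rewrite qE subr0 size_mulXn ?leq_addl//.
  by apply: contra_neq s0 => ->; rewrite coef0.
(* Solving s(A) r = 0 for its constant term gives r = A w with w in the Krylov space. *)
pose w : 'cV[R]_N.+1 := \sum_(j < p) (- s`_j.+1 / s`_0) *: (A ^+ j *m r).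
have Aw : A *m w = r.
  apply: (scalerI s0); apply/eqP; rewrite -subr_eq0 -oppr_eq0 opprB -sr.
  apply/eqP; rewrite (horner_mx_mulE A r sp) big_ord_recl/= mul1mx.
  rewrite mulmx_sumr scaler_sumr -sumrN; congr (_ + _).
  apply: eq_bigr => j _; rewrite -scalemxAr scalerA mulrCA divff// mulr1.
  by rewrite scaleNr opprK mulmxA exprS.
have x1 : residual A b (x0 + w) = 0.
  by rewrite /residual mulmxDr Aw opprD addrA subrr.
exists (x0 + w); split => //; split; first by exists (fun j => - s`_j.+1 / s`_0).
move=> x _; rewrite x1 /norm2 [X in X <= _](_ : _ = 0) ?sqrtr_ge0//.
by rewrite big1 ?sqrtr0// => i _; rewrite mxE expr0n.
Qed.

Lemma gmres_exact_termination (N d e : nat) (A : 'M[R]_N) (S : 'M[R]_(d, N))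
    (c : R) (b x0 : 'cV[R]_N) :
  A \in unitmx ->
  (forall y : 'cV[R]_N, S *m y = 0 -> (A - c%:M) ^+ e *m y = 0) ->
  exists xp, gmres_iterate A b x0 (d + e) xp /\ residual A b xp = 0.
Proof.
case: N A S b x0 => [|N] A S b x0 Au SK.
  exists x0; split; last by rewrite [LHS]flatmx0.
  split; last by move=> x _; rewrite [x]flatmx0 [x0]flatmx0.
  by exists (fun=> 0); rewrite [LHS]flatmx0 [RHS]flatmx0.
have [q [q0 sq qr]] := krylov_annihilator (residual A b x0) SK.
exact: gmres_annihilated qr.
Qed.

End ExactTermination.

(** * Sparsity of the shooting matrix and nilpotency of A - 1 *)

Section Shooting.
Variables (R : realType) (n k : nat).
Variables (phi : 'rV[R]_n -> R -> 'rV[R]_n) (xbar u1 : 'rV[R]_n).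
Variables (g : 'I_k -> (R -> 'rV[R]_n) -> R -> R) (c : 'I_k -> R).
Implicit Types (y z v : 'rV[R]_(k.-1 * n + k + 1)).

Let F := shooting_map phi xbar u1 g c.

(* [seg_start 0 u1 v] is the linear part of [seg_start xbar u1] applied to v.  *)
Lemma seg_start_affine z v (h : R) i :
  seg_start xbar u1 (h *: v + z) i
  = seg_start xbar u1 z i + h *: seg_start 0 u1 v i.
Proof.
rewrite /seg_start; case: pickP => [j _|_].
  by rewrite /nodes !linearP addrC.
by rewrite add0r /eps !mxE scalerDl scalerA [X in _ + X = _]addrC addrA.
Qed.

Lemma seg_time_affine z v (h : R) i :
  seg_time (h *: v + z) i = seg_time z i + h * seg_time v i.
Proof. by rewrite /seg_time !mxE addrC. Qed.

(** Along v, segment i keeps its start and time, so its end point is frozen and the matching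
    equation varies only through node j. *)
Lemma derive_nodes z v i (j : 'I_k.-1) :
  differentiable F z -> seg_start 0 u1 v i = 0 -> seg_time v i = 0 ->
  widen_ord (leq_pred k) j = i ->
  row j (vec_mx (lsubmx ('D_v F z))) = row j (nodes v).
Proof.
move=> dF v0 t0 ji; apply/rowP => l.
rewrite derive_mx; last exact: diff_derivable.
rewrite !mxE; apply: derive_affine_line => h.
rewrite /F /shooting_map !row_mxEl !mxvecE !mxE /segment ji.
rewrite seg_start_affine seg_time_affine v0 t0 scaler0 mulr0 !addr0.
by rewrite -addrA [LHS]addrC.
Qed.

Lemma derive_boundary z v i :
  differentiable F z -> seg_start 0 u1 v i = 0 -> seg_time v i = 0 ->
  rsubmx ('D_v F z) 0 i = 0.
Proof.
move=> dF v0 t0; rewrite derive_mx; last exact: diff_derivable.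
rewrite !mxE; apply: derive_affine_line => h.
rewrite /F /shooting_map !row_mxEr !mxE /segment.
by rewrite seg_start_affine seg_time_affine v0 t0 !scaler0 mulr0 !addr0.
Qed.

Variables (z tau : 'rV[R]_(k.-1 * n + k + 1)).
Let A := shooting_matrix phi xbar u1 g c z tau.
Hypotheses (k_gt0 : (0 < k)%N) (A_unit : A \in unitmx).

(* The library's differential of a non-differentiable map is 0, which would    *)
(* give A a zero row; so invertibility of A makes F differentiable at z, and   *)
(* the smooth dependence of the flow on its initial point is not needed.       *)
Lemma shooting_map_differentiable : differentiable F z.
Proof.
apply: contrapT => ndF; move: A_unit.
have J0 : jacobian F z = 0.
  by apply/matrixP => i j; rewrite !mxE diff_not_differentiable// mxE.
rewrite -row_free_unit /A /shooting_matrix -/F J0 trmx0 => /row_freeP[B].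
move/matrixP => /(_ (lshift 1 (rshift _ (Ordinal k_gt0)))).
move=> /(_ (lshift 1 (rshift _ (Ordinal k_gt0)))).
rewrite !mxE eqxx big1 => [/esym/eqP|i _]; first by rewrite oner_eq0.
by rewrite col_mxEu mxE mul0r.
Qed.

Lemma shooting_matrix_mul (y : 'cV[R]_(k.-1 * n + k + 1)) :
  lsubmx (A *m y)^T = 'D_(y^T) F z.
Proof.
rewrite deriveEjacobian; last exact: shooting_map_differentiable.
by rewrite /A /shooting_matrix mul_col_mx tr_col_mx row_mxKl trmx_mul trmxK.
Qed.

Let X := A - 1%:M.

Lemma shift_nodes y0 i (j : 'I_k.-1) :
  seg_start 0 u1 y0 i = 0 -> seg_time y0 i = 0 ->
  widen_ord (leq_pred k) j = i -> row j (nodes (X *m y0^T)^T) = 0.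
Proof.
move=> v0 t0 ji; rewrite mulmxBl mul1mx /nodes !linearB/= shooting_matrix_mul.
rewrite !trmxK (derive_nodes _ v0 t0 ji) ?subrr//.
exact: shooting_map_differentiable.
Qed.

Lemma shift_time y0 i :
  seg_start 0 u1 y0 i = 0 -> seg_time y0 i = 0 ->
  seg_time (X *m y0^T)^T i = 0.
Proof.
move=> v0 t0; rewrite mulmxBl mul1mx /seg_time !linearB/= shooting_matrix_mul.
rewrite !trmxK mxE derive_boundary//; last exact: shooting_map_differentiable.
by rewrite mxE [X in - X]t0 subr0.
Qed.

(* Indices run from 0: segment i starts to vanish at the i-th iterate.         *)
Lemma shooting_nilpotent (y : 'cV[R]_(k.-1 * n + k + 1)) :
  (forall i : 'I_k, seg_time (X ^+ i *m y)^T i = 0) ->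
  (forall i : 'I_k, eps (X ^+ i *m y)^T = 0) -> X ^+ k.-1 *m y = 0.
Proof.
move=> time0 eps0.
have stepE q : X ^+ q.+1 *m y = X *m (X ^+ q *m y)^T^T.
  by rewrite trmxK mulmxA exprS.
(* Segment i vanishes at every iterate from the i-th on. Its start at iterate p is controlled by the
   previous segment at p-1, or by eps for i = 0; hence the induction on a bound m for i. *)
have V m (i : 'I_k) q : (i < m)%N -> (i <= q < k)%N ->
    seg_start 0 u1 (X ^+ q *m y)^T i = 0 /\ seg_time (X ^+ q *m y)^T i = 0.
  elim: m i q => // m IHm i q im iqk.
  have start p : (i <= p < k)%N -> seg_start 0 u1 (X ^+ p *m y)^T i = 0.
    move=> /andP[ip pk]; rewrite /seg_start; case: pickP => [j /eqP ji|_].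
      case: p ip pk => [|p] ip pk; first by rewrite -ji in ip.
      have jp : (j <= p)%N by rewrite -ltnS ji.
      have [||v0 t0] := IHm (widen_ord (leq_pred k) j) p.
      - by rewrite /= -ltnS ji.
      - by rewrite /= jp ltnW.
      by rewrite stepE (shift_nodes v0 t0).
    by rewrite (eps0 (Ordinal pk)) scale0r addr0.
  split; first exact: start.
  (* The time vanishes by hypothesis at iterate i and by [shift_time] afterwards. *)
  elim: q iqk => [|q IHq] /andP[iq qk].
    by have := time0 i; have -> : nat_of_ord i = 0%N by case: (nat_of_ord i) iq.
  have [iSq|iq'] := eqVneq (i : nat) q.+1; first by rewrite -iSq.
  have iqk : (i <= q < k)%N by rewrite -ltnS ltn_neqAle iq' iq ltnW.
  by rewrite stepE (shift_time (start _ iqk) (IHq iqk)).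
have predk : (k.-1 < k)%N by rewrite ltn_predL.
set w := (X ^+ k.-1 *m y)^T in V *.
(* At iterate k-1 every segment has been reached; starts, times and eps cover all coordinates of
   w. *)
have wV i : seg_start 0 u1 w i = 0 /\ seg_time w i = 0.
  by apply: (V k); rewrite // predk andbT -ltnS prednK.
suff w0 : w = 0 by rewrite -[LHS]trmxK -/w w0 trmx0.
have ew : rsubmx w = 0.
  by apply/rowP => i; rewrite ord1 [RHS]mxE; exact: (eps0 (Ordinal predk)).
have tw : rsubmx (lsubmx w) = 0.
  by apply/rowP => i; rewrite [RHS]mxE; have [] := wV i.
have nw : lsubmx (lsubmx w) = 0.
  rewrite -[LHS]vec_mxK -[RHS](linear0 mxvec); congr mxvec.
  apply/row_matrixP => j; rewrite row0.
  have jk : (j.+1 < k)%N by rewrite -[X in (_ < X)%N](prednK k_gt0) ltnS.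
  have [+ _] := wV (Ordinal jk); rewrite /seg_start; case: pickP => [l|].
    by rewrite eqSS => /eqP /val_inj ->.
  by move=> /(_ j); rewrite eqxx.
by rewrite -[w]hsubmxK -[lsubmx w]hsubmxK ew tw nw !row_mx0.
Qed.

End Shooting.

Theorem proposition4p2 (R : realType) (n k : nat) (k_ge2 : (2 <= k)%N)
    (f : 'rV[R]_n -> 'rV[R]_n) (f_smooth : smooth f)
    (D : set ('rV[R]_n * R)) (phi : 'rV[R]_n -> R -> 'rV[R]_n)
    (phi_flow : is_flow f D phi)
    (xbar : 'rV[R]_n) (P : R)
    (xbar_hyp : hyperbolic_periodic_point f D phi xbar P)
    (mu1 : R) (u1 : 'rV[R]_n)
    (mu1_unstable : one_unstable_multiplier (monodromy phi xbar P) mu1 u1)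
    (g : 'I_k -> (R -> 'rV[R]_n) -> R -> R) (c : 'I_k -> R)
    (z : 'rV[R]_(k.-1 * n + k + 1))
    (times_ge0 : forall i : 'I_k, 0 <= seg_time z i)
    (segments_in_D :
       forall i : 'I_k, D (seg_start xbar u1 z i, seg_time z i))
    (g_diff : forall i : 'I_k,
       differentiable (fun q : 'rV[R]_n * R => g i (phi q.1) q.2)
         (seg_start xbar u1 z i, seg_time z i))
    (tau : 'rV[R]_(k.-1 * n + k + 1)) :
  let A := shooting_matrix phi xbar u1 g c z tau in
  let b := shooting_rhs phi xbar u1 g c z in
  A \in unitmx ->
  (forall l : R[i], ceigenvalue A l -> l != 1 -> simple_ceigenvalue A l) ->
  forall x0 : 'cV[R]_(k.-1 * n + k + 1),
    exists p : nat, (p <= 3 * k - 1)%N /\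
      exists xp, gmres_iterate A b x0 p xp /\ residual A b xp = 0.
Proof.
move=> A b A_unit _ x0; have k_gt0 : (0 < k)%N := ltnW k_ge2.
exists ((k + k) + k.-1)%N; split.
  by rewrite -subn1 addnBA// !mulSn mul0n addn0 addnA.
pose X := A - 1%:M.
(* Row i of the two blocks reads the i-th time and eps of [X ^+ i *m y]: the 2k conditions of
   [shooting_nilpotent]. *)
pose S : 'M[R]_(k + k, _) := col_mx
  (\matrix_(i < k) row (lshift 1 (rshift (k.-1 * n) i)) (X ^+ i))
  (\matrix_(i < k) row (rshift (k.-1 * n + k) ord0) (X ^+ i)).
apply: (@gmres_exact_termination _ _ _ _ _ S 1) => // y.
rewrite mul_col_mx -[X in _ = X](@col_mx0 _ k k) => /eq_col_mx[tS eS].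
apply: shooting_nilpotent => // i.
- move/row_matrixP : tS => /(_ i); rewrite row_mul rowK -row_mul row0.
  by move/matrixP => /(_ 0 0); rewrite /seg_time !mxE.
- move/row_matrixP : eS => /(_ i); rewrite row_mul rowK -row_mul row0.
  by move/matrixP => /(_ 0 0); rewrite /eps !mxE.
Qed.
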